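(* Let $A\in\mathbb{R}^{m\times n}$, $b\in\mathbb{R}^m$ and $\varepsilon\geq 0$. Assume that either $A$ has full row-rank or $\varepsilon>0$, and that there is $y\in\mathbb{R}^n$ such that, if $\varepsilon=0$, then $Ay=b$ and, if $\varepsilon>0$, then $\|Ay-b\|<\varepsilon$. Let $\mathcal{C}=\{x\in\mathbb{R}^n : \|Ax-b\|\leq\varepsilon\}$. Then for every $x\in\mathbb{R}^n$ $$P_{\mathcal{C}}(x) = \begin{cases} x & \text{if } \|Ax-b\|\leq\varepsilon,\\ x - A^\top(AA^\top+\varepsilon\tau_x\mathrm{I})^{-1}(Ax-b) & \text{otherwise,}\end{cases}$$ where, if $\|Ax-b\|>\varepsilon$, the scalar $\tau_x$ is the unique positive solution to $$1=\tau\,\|(AA^\top+\varepsilon\tau\mathrm{I})^{-1}(Ax-b)\|.$$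
   Context: $\|\cdot\|$ is the Euclidean norm and $\mathrm{I}$ is the identity matrix. For a nonempty closed convex set $\mathcal{C}\subseteq\mathbb{R}^n$, $P_{\mathcal{C}}(x)=\operatorname{argmin}_{u\in\mathcal{C}}\tfrac12\|u-x\|^2$ is the Euclidean projection onto $\mathcal{C}$. The claim includes existence and uniqueness of the positive solution $\tau_x$ when $\|Ax-b\|>\varepsilon$. *)

(* Defs.v *)
From mathcomp Require Import all_boot all_order all_algebra.
From mathcomp Require Import classical_sets reals.

Set Implicit Arguments.
Unset Strict Implicit.
Unset Printing Implicit Defensive.

Import Order.TTheory GRing.Theory Num.Theory.

Local Open Scope classical_set_scope.
Local Open Scope ring_scope.

(* The library norm `|x| on matrices is the sup norm, hence this definition. *)
Definition enorm (R : realType) (k : nat) (x : 'cV[R]_k) : R :=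
  Num.sqrt (\sum_(i < k) x i ord0 ^+ 2).

Definition argmin (R : realType) (T : Type) (C : set T) (f : T -> R) : set T :=
  [set u | C u /\ forall v, C v -> f u <= f v].

(* Set-valued: [proj C x = [set p]] says that the minimizer exists, is unique
   and equals [p], i.e. P_C(x) = p. *)
Definition proj (R : realType) (n : nat) (C : set 'cV[R]_n) (x : 'cV[R]_n) :
  set 'cV[R]_n :=
  argmin C (fun u => 2^-1 * enorm (u - x) ^+ 2).

(* Main.v *)
(** Write r = Ax - b, z(t) = (AA^T + eps t I)^-1 r and p(t) = x - A^T z(t).
    If t |z(t)| = 1 then Ap(t) - b = eps t z(t) has norm eps, and Cauchy-Schwarz
    gives <x - p(t), v - p(t)> <= 0 for every feasible v, so p(t) is the
    projection of x. If eps > 0, uniqueness of t follows from uniqueness of the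
    projection: two solutions share p, hence A^T z and t z, and A^T z <> 0 because
    x is not feasible; if eps = 0, z does not depend on t. For eps > 0 the
    existence of s = eps t comes from the intermediate value theorem for
    polynomials, since after clearing denominators by the adjugate the equation
    s^2 |(AA^T + s I)^-1 r|^2 = eps^2 is polynomial in s. *)
Require Import Defs.
From mathcomp Require Import all_boot all_order all_algebra.
From mathcomp Require Import classical_sets reals.
From mathcomp Require Import ring lra.

Set Implicit Arguments.
Unset Strict Implicit.
Unset Printing Implicit Defensive.

Import Order.TTheory GRing.Theory Num.Theory.

Local Open Scope classical_set_scope.
Local Open Scope ring_scope.

(** * Euclidean inner product, norm and projections *)

Definition dot (R : realType) (k : nat) (u v : 'cV[R]_k) : R :=
  \sum_(i < k) u i ord0 * v i ord0.

Section EuclideanSpace.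
Variables (R : realType).

Lemma dotC k (u v : 'cV[R]_k) : dot u v = dot v u.
Proof. by apply: eq_bigr => i _; rewrite mulrC. Qed.

Lemma dotDl k (u v w : 'cV[R]_k) : dot (u + v) w = dot u w + dot v w.
Proof. by rewrite /dot -big_split; apply: eq_bigr => i _; rewrite mxE mulrDl. Qed.

Lemma dotZl k a (u w : 'cV[R]_k) : dot (a *: u) w = a * dot u w.
Proof. by rewrite /dot mulr_sumr; apply: eq_bigr => i _; rewrite mxE mulrA. Qed.

Lemma dotNl k (u w : 'cV[R]_k) : dot (- u) w = - dot u w.
Proof. by rewrite -scaleN1r dotZl mulN1r. Qed.

Lemma dotDr k (u v w : 'cV[R]_k) : dot u (v + w) = dot u v + dot u w.
Proof. by rewrite dotC dotDl !(dotC u). Qed.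

Lemma dotZr k a (u w : 'cV[R]_k) : dot u (a *: w) = a * dot u w.
Proof. by rewrite dotC dotZl dotC. Qed.

Lemma dotNr k (u w : 'cV[R]_k) : dot u (- w) = - dot u w.
Proof. by rewrite dotC dotNl dotC. Qed.

Lemma dot0l k (u : 'cV[R]_k) : dot 0 u = 0.
Proof. by rewrite -(scale0r u) dotZl mul0r. Qed.

Definition dotE := (dotDl, dotDr, dotZl, dotZr, dotNl, dotNr).

Lemma dot_mulmxr m n (A : 'M[R]_(m, n)) u v : dot u (A *m v) = dot (A^T *m u) v.
Proof.
have dotM k (a c : 'cV[R]_k) : dot a c = (a^T *m c) ord0 ord0.
  by rewrite mxE; apply: eq_bigr => i _; rewrite mxE.
by rewrite !dotM trmx_mul trmxK mulmxA.
Qed.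

Lemma dot_ge0 k (u : 'cV[R]_k) : 0 <= dot u u.
Proof. by apply: sumr_ge0 => i _; rewrite -expr2 sqr_ge0. Qed.

Lemma dot_eq0 k (u : 'cV[R]_k) : (dot u u == 0) = (u == 0).
Proof.
apply/idP/eqP => [|->]; last by rewrite dot0l.
rewrite psumr_eq0 => [/allP u0|i _]; last by rewrite -expr2 sqr_ge0.
apply/colP => i; rewrite mxE; have := u0 i (mem_index_enum i).
by rewrite mulf_eq0 orbb => /eqP.
Qed.

Lemma enorm_ge0 k (u : 'cV[R]_k) : 0 <= enorm u.
Proof. exact: sqrtr_ge0. Qed.

Lemma enorm_sqr k (u : 'cV[R]_k) : enorm u ^+ 2 = dot u u.
Proof.
rewrite sqr_sqrtr; last by apply: sumr_ge0 => i _; rewrite sqr_ge0.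
by apply: eq_bigr => i _; rewrite expr2.
Qed.

Lemma enorm_eq0 k (u : 'cV[R]_k) : (enorm u == 0) = (u == 0).
Proof. by rewrite -dot_eq0 -enorm_sqr sqrf_eq0. Qed.

Lemma enorm_gt0 k (u : 'cV[R]_k) : (0 < enorm u) = (u != 0).
Proof. by rewrite lt_def enorm_ge0 andbT enorm_eq0. Qed.

Lemma enormZ k a (u : 'cV[R]_k) : 0 <= a -> enorm (a *: u) = a * enorm u.
Proof.
move=> a0; apply/eqP; rewrite -(eqrXn2 (n := 2)) ?mulr_ge0 ?enorm_ge0 //.
by rewrite exprMn !enorm_sqr !dotE mulrA -expr2.
Qed.

(** Expanding the squared norm of |v| u - |u| v gives 2 |u| |v| (|u| |v| - <u, v>) >= 0; zero
    vectors are split off so that |u| |v| can be cancelled. *)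
Lemma dot_le_enorm k (u v : 'cV[R]_k) : dot u v <= enorm u * enorm v.
Proof.
have [->|u0] := eqVneq u 0; first by rewrite dot0l mulr_ge0 ?enorm_ge0.
have [->|v0] := eqVneq v 0; first by rewrite dotC dot0l mulr_ge0 ?enorm_ge0.
rewrite -enorm_gt0 in u0; rewrite -enorm_gt0 in v0.
have := dot_ge0 (enorm v *: u - enorm u *: v).
rewrite !dotE -!enorm_sqr (dotC v u).
set a := enorm u in u0 *; set c := enorm v in v0 *; set d := dot u v.
move=> h; rewrite -subr_ge0 -(pmulr_rge0 _ (mulr_gt0 u0 v0)); nra.
Qed.

(** Expanding |v - x|^2 about p leaves |p - x|^2 + |v - p|^2 minus twice a nonpositive product; the
    extra |v - p|^2 yields minimality and uniqueness together. *)
Lemma proj_variational n (C : set 'cV[R]_n) (x p : 'cV[R]_n) :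
  C p -> (forall v, C v -> dot (x - p) (v - p) <= 0) -> proj C x = [set p].
Proof.
move=> Cp var.
have pythagoras v : C v ->
    enorm (p - x) ^+ 2 + dot (v - p) (v - p) <= enorm (v - x) ^+ 2.
  move=> /var; rewrite !enorm_sqr.
  rewrite (_ : v - x = (v - p) - (x - p)); last by rewrite opprB addrA subrK.
  rewrite -(opprB x p) dotNl dotNr opprK; move: (x - p) (v - p) => a d.
  by rewrite !dotE (dotC d a); lra.
apply/seteqP; split => [u [Cu umin]|u ->] /=.
  apply/eqP; rewrite -subr_eq0 -dot_eq0 eq_le dot_ge0 andbT.
  by have := umin p Cp; have := pythagoras u Cu; lra.
split=> // v /pythagoras; have := dot_ge0 (v - p); lra.
Qed.

End EuclideanSpace.

(** * The shifted Gram matrix and the equation for the shift *)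

Section RegularizedGram.
Variables (R : realType) (m n : nat) (A : 'M[R]_(m, n)).

Let M (s : R) : 'M[R]_m := A *m A^T + s%:M.

Lemma dot_gram_shift s (z : 'cV[R]_m) :
  dot z (M s *m z) = dot (A^T *m z) (A^T *m z) + s * dot z z.
Proof.
by rewrite /M mulmxDl mul_scalar_mx dotDr dotZr -mulmxA dot_mulmxr.
Qed.

(** A kernel vector z satisfies |A^T z|^2 + s |z|^2 = 0, so both terms vanish: s > 0 forces z = 0
    directly, and for s = 0 full row rank does. *)
Lemma gram_shift_unitmx s : 0 <= s -> row_free A \/ 0 < s -> M s \in unitmx.
Proof.
(* [kermx] is a left kernel; the transpose is taken to reach columns killed by [M s]. *)
move=> s0 As; rewrite -unitmx_tr -row_free_unit -kermx_eq0.
apply/eqP/row_matrixP => i; rewrite row0.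
set w := row i _; have wM : w *m (M s)^T = 0.
  by apply/sub_kermxP/row_sub.
have Mw : M s *m w^T = 0 by rewrite -[M s]trmxK -trmx_mul wM trmx0.
suff /eqP w0 : w^T == 0 by rewrite -[w]trmxK w0 trmx0.
have := dot_gram_shift s w^T; rewrite Mw dotC dot0l => /esym/eqP.
rewrite paddr_eq0 ?dot_ge0 ?mulr_ge0 ?dot_ge0 // mulf_eq0 !dot_eq0.
case/andP => Aw /orP[/eqP s00|//]; case: As => [freeA|]; last first.
  by rewrite s00 ltxx.
rewrite -trmx_eq0 trmx_mul !trmxK in Aw; rewrite -trmx_eq0 trmxK.
by move: Aw; rewrite mulmx_free_eq0.
Qed.

(** Left endpoint for the intermediate value theorem. Pairing the equation with z and bounding <A^T
    z, d> by (|A^T z|^2 + |d|^2) / 2 gives s |z|^2 <= |z| |e| + |d|^2 / 2, which for s |z| > c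
    contradicts the bound on s |d|^2. *)
Lemma shifted_residual_small s (d : 'cV[R]_n) (e z : 'cV[R]_m) (c : R) :
  0 < s -> 0 < c -> enorm e < c -> s * dot d d <= c * (c - enorm e) ->
  M s *m z = A *m d + e -> s * enorm z <= c.
Proof.
move=> s0 c0 ec sd Mz; rewrite leNgt; apply/negP => cz.
have := dot_gram_shift s z; rewrite Mz dotDr dot_mulmxr -(enorm_sqr z).
have := dot_le_enorm z e.
have := dot_ge0 (A^T *m z - d); have := dot_ge0 (A^T *m z).
rewrite !dotE (dotC d); move: (dot _ d) (dot _ (A^T *m z)) => a q q0 h1 h2 h3.
have h4 : s * enorm z ^+ 2 <= enorm z * enorm e + dot d d / 2 by lra.
have h5 : (s * enorm z) * (s * enorm z - enorm e) <= s * dot d d / 2 by nra.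
have h6 : c * (c - enorm e) < (s * enorm z) * (s * enorm z - enorm e).
  by apply: ltr_pM; rewrite ?subr_ge0 ?ltrD2r ?ltW.
have := dot_ge0 d; nra.
Qed.

(** Right endpoint: pairing with r gives |r|^2 <= (s |r| + |A A^T r|) |z|, and s |r|^2 / (s |r| + |A
    A^T r|) reaches c once s is large. *)
Lemma shifted_residual_large s (r z : 'cV[R]_m) (c : R) :
  0 < s -> c < enorm r -> 0 <= c ->
  c * enorm (A *m A^T *m r) <= s * (enorm r * (enorm r - c)) ->
  M s *m z = r -> c <= s * enorm z.
Proof.
move=> s0 cr c0 ks Mz.
have r0 : 0 < enorm r by apply: le_lt_trans cr.
have : enorm r ^+ 2 <= (s * enorm r + enorm (A *m A^T *m r)) * enorm z.
  rewrite enorm_sqr -{2}Mz mulmxDl mul_scalar_mx !dotE -mulmxA 2!dot_mulmxr.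
  rewrite trmxK mulmxA.
  have := dot_le_enorm r z; have := dot_le_enorm (A *m A^T *m r) z; nra.
set k := enorm (A *m _ *m _) in ks *; set a := enorm r in ks r0 cr *.
have := enorm_ge0 (A *m A^T *m r); rewrite -/k; have := enorm_ge0 z.
move: (enorm z) => b b0 k0 h.
rewrite -(ler_pM2r (_ : 0 < s * a + k)); first by nra.
by rewrite ltr_wpDr ?mulr_gt0.
Qed.

(** By Cramer's rule, det(M s) (M s)^-1 r = adj(M s) r is polynomial in s. Norms are squared to stay
    polynomial, and the positive factor det^2 preserves signs. *)
Lemma gram_shift_secular_poly (r : 'cV[R]_m) (c : R) : {p : {poly R} | forall s,
  M s \in unitmx ->
  p.[s] = \det (M s) ^+ 2 * ((s * enorm (invmx (M s) *m r)) ^+ 2 - c ^+ 2)}.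
Proof.
(* [P] is [M s] with s replaced by the indeterminate; evaluation at s commutes with determinant and
   adjugate. *)
pose P : 'M[{poly R}]_m := map_mx polyC (A *m A^T) + 'X%:M.
pose q := \adj P *m map_mx polyC r.
exists ('X ^+ 2 * \sum_i q i ord0 ^+ 2 - (c ^+ 2)%:P * (\det P) ^+ 2) => s Ms.
have evC k l (B : 'M[R]_(k, l)) : map_mx (horner_eval s) (map_mx polyC B) = B.
  by apply/matrixP => i j; rewrite !mxE /horner_eval hornerC.
have evP : map_mx (horner_eval s) P = M s.
  by rewrite map_mxD evC map_scalar_mx /= /horner_eval hornerX.
have evdet : (\det P).[s] = \det (M s).
  by rewrite -evP det_map_mx.
have evq : map_mx (horner_eval s) q = \adj (M s) *m r.
  by rewrite map_mxM map_mx_adj evP evC.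
have -> : invmx (M s) *m r = (\det (M s))^-1 *: map_mx (horner_eval s) q.
  by rewrite evq /invmx Ms scalemxAl.
rewrite hornerD hornerN !hornerM hornerX hornerC horner_sum evdet exprMn enorm_sqr !dotE.
have d0 : \det (M s) != 0 by rewrite -unitfE -unitmxE.
have -> : \sum_i (q i ord0 ^+ 2).[s] =
    dot (map_mx (horner_eval s) q) (map_mx (horner_eval s) q).
  by apply: eq_bigr => i _; rewrite !mxE horner_exp -expr2.
by field.
Qed.

Lemma secular_root_exists (x : 'cV[R]_n) (b : 'cV[R]_m) (y : 'cV[R]_n) (c : R) :
  0 < c -> enorm (A *m y - b) < c -> c < enorm (A *m x - b) ->
  exists2 s, 0 < s & s * enorm (invmx (M s) *m (A *m x - b)) = c.
Proof.
move=> c0 yc; set r := _ - b => rc.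
have unitM s : 0 < s -> M s \in unitmx.
  by move=> s0; apply: gram_shift_unitmx; [exact: ltW | right].
have MK s : 0 < s -> M s *m (invmx (M s) *m r) = r.
  by move=> /unitM Ms; rewrite mulKVmx.
have r0 := lt_trans c0 rc.
have [p pE] := gram_shift_secular_poly r c.
pose d := x - y; pose e := A *m y - b.
have re : r = A *m d + e by rewrite mulmxBr addrA subrK.
(* Chosen so that [s1 * dot d d <= c * (c - enorm e)]; the [+ 1] guards against d = 0. *)
pose s1 := c * (c - enorm e) / (dot d d + 1).
have dd : 0 < dot d d + 1 by rewrite ltr_wpDl ?dot_ge0.
have s1_gt0 : 0 < s1 by rewrite divr_gt0 // mulr_gt0 // subr_gt0.
pose k := enorm (A *m A^T *m r).
have rrc : 0 < enorm r * (enorm r - c) by rewrite mulr_gt0 // subr_gt0.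
(* The second term alone meets the condition of [shifted_residual_large] with equality; adding [s1]
   orders the endpoints. *)
pose s2 := s1 + c * k / (enorm r * (enorm r - c)).
have s12 : s1 <= s2.
  by rewrite lerDl divr_ge0 ?(ltW rrc) // mulr_ge0 ?enorm_ge0 // ltW.
have small : s1 * enorm (invmx (M s1) *m r) <= c.
  apply: (@shifted_residual_small _ d e); rewrite -?re ?MK //.
  rewrite /s1 mulrAC ler_pdivrMr // ler_pM2l ?lerDl //.
  by rewrite mulr_gt0 // subr_gt0.
have s2_gt0 := lt_le_trans s1_gt0 s12.
have large : c <= s2 * enorm (invmx (M s2) *m r).
  apply: (shifted_residual_large _ rc); rewrite ?MK ?(ltW c0) //.
  by rewrite /s2 mulrDl divfK ?gt_eqF // lerDr mulr_ge0 ?ltW.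
have [|s /andP[s1s _] /rootP ps] := @poly_ivt _ p s1 s2 s12.
  rewrite !pE ?unitM // pmulr_rge0 ?pmulr_rle0 ?subr_le0 ?subr_ge0.
  - apply/andP; split; rewrite ler_sqr // nnegrE ?(ltW c0) //.
      exact: mulr_ge0 (ltW s1_gt0) (enorm_ge0 _).
    exact: mulr_ge0 (ltW s2_gt0) (enorm_ge0 _).
  - by rewrite exprn_even_gt0 //= -unitfE -unitmxE unitM.
  - by rewrite exprn_even_gt0 //= -unitfE -unitmxE unitM.
have s0 := lt_le_trans s1_gt0 s1s; exists s => //.
move/eqP: ps; rewrite pE ?unitM // mulf_eq0 sqrf_eq0 subr_eq0.
have /negPf-> : \det (M s) != 0 by rewrite -unitfE -unitmxE unitM.
by rewrite eqrXn2 ?mulr_ge0 ?enorm_ge0 ?ltW // => /eqP.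
Qed.

Lemma proj_residual_ball (b : 'cV[R]_m) (eps tau : R) (x : 'cV[R]_n) (z : 'cV[R]_m) :
  0 <= eps -> 0 < tau -> tau * enorm z = 1 -> M (eps * tau) *m z = A *m x - b ->
  proj [set u | enorm (A *m u - b) <= eps] x = [set x - A^T *m z].
Proof.
move=> eps0 tau0 tz Mz.
have Ap : A *m (x - A^T *m z) - b = (eps * tau) *: z.
  by rewrite mulmxBr addrAC -Mz mulmxDl mul_scalar_mx mulmxA addrAC subrr add0r.
apply: proj_variational => [|v /= vC].
  by rewrite /= Ap enormZ ?mulr_ge0 ?(ltW tau0) // -mulrA tz mulr1.
(* Since x - p = A^T z, the product becomes <z, (Av - b) - (Ap - b)> = <z, Av - b> - eps |z|. *)
rewrite subKr -dot_mulmxr mulmxBr.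
rewrite (_ : A *m v - _ = A *m v - b - (A *m (x - A^T *m z) - b)); last first.
  by rewrite opprB addrA subrK.
rewrite Ap dotDr dotNr dotZr -enorm_sqr expr2 -mulrA (mulrA tau) tz mul1r subr_le0.
by apply: le_trans (dot_le_enorm _ _) _; rewrite mulrC ler_wpM2r ?enorm_ge0.
Qed.

End RegularizedGram.

(** * The projection formula and uniqueness of the multiplier *)

Theorem proposition1 (R : realType) (m n : nat) (A : 'M[R]_(m, n))
    (b : 'cV[R]_m) (eps : R) (heps : 0 <= eps)
    (hA : row_free A \/ 0 < eps)
    (hy : exists y : 'cV[R]_n,
        (eps = 0 -> A *m y = b) /\ (0 < eps -> enorm (A *m y - b) < eps)) :
  let C : set 'cV[R]_n := [set u | enorm (A *m u - b) <= eps] in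
  let M (t : R) : 'M[R]_m := A *m A^T + (eps * t)%:M in
  forall x : 'cV[R]_n,
    (enorm (A *m x - b) <= eps -> proj C x = [set x]) /\
    (eps < enorm (A *m x - b) ->
       (forall t : R, 0 < t -> M t \in unitmx) /\
       exists tau : R,
         unique (fun t : R =>
                   0 < t /\ 1 = t * enorm (invmx (M t) *m (A *m x - b))) tau /\
         proj C x = [set x - A^T *m invmx (M tau) *m (A *m x - b)]).
Proof.
move=> C M x; split=> [xC|xNC].
  by apply: proj_variational => // v _; rewrite subrr dot0l.
have unitM t : 0 < t -> M t \in unitmx.
  move=> t0; apply: gram_shift_unitmx; first by rewrite mulr_ge0 ?(ltW t0).
  by case: hA => [|e0]; [left | right; rewrite mulr_gt0].
split=> //; set r := A *m x - b in xNC *.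
pose z t := invmx (M t) *m r.
have Mz t : 0 < t -> M t *m z t = r by move=> t0; rewrite mulKVmx ?unitM.
have projE t : 0 < t -> 1 = t * enorm (z t) -> proj C x = [set x - A^T *m z t].
  by move=> t0 tz; apply: (proj_residual_ball heps t0 (esym tz)); exact: Mz.
have r0 : r != 0 by rewrite -enorm_gt0; apply: le_lt_trans xNC.
have z_neq0 t : 0 < t -> z t != 0.
  by move=> /Mz Mt; apply: contra_neq r0 => zt; rewrite -Mt zt mulmx0.
have [tau tau0 tauE] : exists2 tau, 0 < tau & 1 = tau * enorm (z tau).
  have [y [_ hy0]] := hy.
  move: heps; rewrite le_eqVlt => /orP[/eqP eps0|eps_gt0].
    have zc t : z t = z 1 by rewrite /z /M -eps0 !mul0r.
    have z1 : 0 < enorm (z 1) by rewrite enorm_gt0 z_neq0.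
    by exists (enorm (z 1))^-1; rewrite ?invr_gt0 // zc mulVf ?gt_eqF.
  have [s s0 sE] := secular_root_exists eps_gt0 (hy0 eps_gt0) xNC.
  have eps_neq0 := lt0r_neq0 eps_gt0.
  (* The equation was solved in s = eps tau. *)
  exists (s / eps); first exact: divr_gt0.
  by rewrite /z /M mulrCA divff // mulr1 mulrAC sE divff.
exists tau; split; last by rewrite (projE tau) // /z mulmxA.
split=> // t [t0 tE].
have AzE : A^T *m z tau = A^T *m z t.
  have : [set x - A^T *m z tau] = [set x - A^T *m z t] by rewrite -!projE.
  by move=> /seteqP[/(_ _ erefl) /addrI/oppr_inj].
(* Both sides of M(tau) z(tau) = r = M(t) z(t) share the term A A^T z, which cancels. *)
have zE : (eps * tau) *: z tau = (eps * t) *: z t.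
  have := etrans (Mz _ tau0) (esym (Mz _ t0)).
  by rewrite !mulmxDl !mul_scalar_mx -!mulmxA AzE => /addrI.
move: heps; rewrite le_eqVlt => /orP[/eqP eps0|eps_gt0].
  have zc u : z u = z 1 by rewrite /z /M -eps0 !mul0r.
  have z1 : enorm (z 1) != 0 by rewrite enorm_eq0 z_neq0.
  by apply: (mulIf z1); rewrite -{1}(zc tau) -tauE -(zc t).
(* Otherwise r = eps t z(t) would have norm eps, against the infeasibility of x. *)
have Az0 : A^T *m z t != 0.
  apply: contraTneq xNC => Az0; rewrite -leNgt.
  have := Mz t t0; rewrite mulmxDl mul_scalar_mx -mulmxA Az0 mulmx0 add0r => <-.
  by rewrite enormZ ?mulr_ge0 ?(ltW t0) ?(ltW eps_gt0) // -mulrA -tE mulr1.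
(* Applying A^T turns [zE] into (eps tau - eps t) A^T z(t) = 0. *)
have := congr1 (mulmx A^T) zE; rewrite -!scalemxAr AzE => /eqP.
rewrite -subr_eq0 -scalerBl scaler_eq0 (negPf Az0) orbF -mulrBr mulf_eq0.
by rewrite gt_eqF //= subr_eq0 => /eqP.
Qed.
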